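(* Let $r\geqslant 2$ be an integer. Let $v=(v(n))_{n\geqslant 1}$ be a sequence in a finite set $A$, and let $\sigma$ be a bijection on $A$. Fix an integer $i$ with $0\leqslant i<r$. Then, for every integer $m\geqslant 0$, the following statement holds: if $(T_{i}v)(n+m)=\sigma(v(n))$ for all integers $n\geqslant 1$, and $T_{j}v$ is $r$-automatic for all integers $j$ with $0\leqslant j<r$ and $j\neq i$, then $v$ is $r$-automatic.
   Context: For a sequence $v=(v(n))_{n\geqslant 1}$ and integers $0\leqslant j<r$, the sequence $T_{j}v=((T_{j}v)(n))_{n\geqslant 1}$ is defined by $(T_{j}v)(n)=v(rn+j)$ for $n\geqslant 1$. A sequence $v=(v(n))_{n\geqslant 1}$ with values in a finite set is called $r$-automatic if its $r$-kernel $K_{r}(v)=\{(v(r^{a}n+b))_{n\geqslant 1}\mid a\geqslant 0,\ 0\leqslant b<r^{a}\}$ is a finite set of sequences. *)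

(* Defs.v *)
From mathcomp Require Import all_boot.
From mathcomp Require Import classical_sets cardinality.
Set Implicit Arguments.
Unset Strict Implicit.
Unset Printing Implicit Defensive.

Local Open Scope classical_set_scope.

(* Sequences are indexed by the integers
   n >= 1, so two sequences are equal when they agree at every n >= 1. *)
Definition posint := {n : nat | 0 < n}.

Definition posint1 : posint := exist _ 1 isT.

Definition posint_val (n : posint) : nat := val n.
Coercion posint_val : posint >-> nat.

Definition sequence (A : Type) := posint -> A.

(* [term v k] is v(k); the value at the out-of-range index k = 0 is arbitrary.
   No index below is 0 when 0 < r. *)
Definition term (A : Type) (v : sequence A) (k : nat) : A :=
  v (insubd posint1 k).

Lemma term_val (A : Type) (v : sequence A) (n : posint) : term v n = v n.
Proof. by rewrite /term /posint_val valKd. Qed.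

Lemma insubd_posintK (k : nat) : 0 < k -> posint_val (insubd posint1 k) = k.
Proof. by move=> k_gt0; rewrite /posint_val insubdK. Qed.

Definition T (A : Type) (r j : nat) (v : sequence A) : sequence A :=
  fun n => term v (r * n + j).

Definition kernel (A : Type) (r : nat) (v : sequence A) : set (sequence A) :=
  [set w | exists a b : nat,
     b < r ^ a /\ w = (fun n : posint => term v (r ^ a * n + b))].

Definition automatic (A : finType) (r : nat) (v : sequence A) : Prop :=
  finite_set (kernel r v).

(* Main.v *)
Require Import Defs.
From mathcomp Require Import all_boot.
From mathcomp Require Import boolp classical_sets cardinality.
From mathcomp Require Import zify.

(** The hypothesis says [v (r * q + i) = sigma (v (q - m))] for [q > m], while
    [v (r * q + j)] is a term of the automatic sequence [T r j v] for [j <> i].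
    Reading off the last base-[r] digit of the argument thus reduces a sequence
    [n |-> v (r ^ a * n + b)], with [a] large, either to the same kind of
    sequence for [a - 1], up to composition with [sigma], or to a sequence
    [n |-> (T r j v) (r ^ (a - 1) * n + b')].

    The shift by [m] makes the new offsets possibly negative, but they stay
    bounded below: if [b >= - r * m] then
    [b %/ r - m >= - 2 * m >= - r * m] because [r >= 2].  Hence the reduction is
    carried out on the family [offset_section], whose offsets range over
    [- M <= b < r ^ a] with [M = r * m] ([kernel_reduction]).  It stops when [a]
    reaches the threshold [a0 = r * m], which ensures [r ^ a > 2 * m] above it,
    so that the relation on [T r i v] applies to all the terms, and [M <= r ^ a].

    Two finiteness facts conclude.  A section of an automatic sequence with
    offset in [- r ^ a, 0[ is, past its first term, a kernel sequence delayed by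
    one, and there are finitely many choices for the first term
    ([automatic_offset_sections]).  All the iterates of [sigma] lie in the finite
    set of maps from [A] to itself ([finite_relabelings]). *)

(** The sequence [n |-> u (r ^ a * n + (c - M))]: writing the offset as [c - M]
    represents a possibly negative integer by the natural number [c]. *)
Definition offset_section {A : Type} (r M : nat) (u : sequence A) (a c : nat) :
    sequence A :=
  fun n => term u (r ^ a * n + c - M).

Definition prepend {A : Type} (x : A) (u : sequence A) : sequence A :=
  fun n => if posint_val n == 1 then x else term u n.-1.

Definition relabelings {A : finType} (G : set (sequence A)) :
    set (sequence A) :=
  [set w | exists g : {ffun A -> A}, exists2 f, G f & w = g \o f]%classic.

Lemma posint_gt0 (n : posint) : 0 < n.
Proof. exact: (valP n). Qed.

Lemma term_T (A : Type) (r j : nat) (v : sequence A) (q : nat) :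
  0 < q -> term (T r j v) q = term v (r * q + j).
Proof. by move=> q_gt0; rewrite {1}/term /T insubd_posintK. Qed.

Lemma finite_relabelings (A : finType) (G : set (sequence A)) :
  finite_set G -> finite_set (relabelings G).
Proof.
move=> finG.
have finX : finite_set ([set: {ffun A -> A}] `*` G)%classic.
  by apply: finite_setX => //; exact: finite_finset.
apply: (sub_finite_set _
  (finite_image (fun p : {ffun A -> A} * sequence A => p.1 \o p.2) finX)).
by move=> _ [g [f Gf ->]]; exists (g, f).
Qed.

Lemma relabelings_self (A : finType) (G : set (sequence A)) (f : sequence A) :
  G f -> relabelings G f.
Proof.
by move=> Gf; exists [ffun x => x], f => //; apply/funext => n /=; rewrite ffunE.
Qed.

Lemma relabelings_comp (A : finType) (G : set (sequence A)) (s : A -> A)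
    (w : sequence A) :
  relabelings G w -> relabelings G (s \o w).
Proof.
move=> [g [f Gf ->]]; exists [ffun x => s (g x)], f => //.
by apply/funext => n /=; rewrite ffunE.
Qed.

(** Negative offsets are absorbed by a delay: for [c < M <= r ^ a],
    [r ^ a * n + (c - M) = r ^ a * (n - 1) + (r ^ a + c - M)], whose new offset
    lies in [[0, r ^ a[]; only the term at [n = 1] is left unconstrained. *)
Lemma automatic_offset_sections (A : finType) (r M : nat) (u : sequence A) :
  automatic r u ->
  finite_set [set w | exists a c, [/\ M <= r ^ a, c < M + r ^ a
                                   & w = offset_section r M u a c]]%classic.
Proof.
move=> autu.
have finX : finite_set ([set: A] `*` kernel r u)%classic.
  by apply: finite_setX => //; exact: finite_finset.
have finP := finite_image (fun p : A * sequence A => prepend p.1 p.2) finX.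
have finU := conj (autu : finite_set (kernel r u)) finP.
rewrite -finite_setU in finU; apply: (sub_finite_set _ finU).
move=> _ [a [c [leM ltc ->]]].
have [leMc|ltcM] := leqP M c.
  left; exists a, (c - M); split; first lia.
  by apply/funext => n; rewrite /offset_section addnBA.
right; exists (offset_section r M u a c posint1,
               fun n : posint => term u (r ^ a * n + (r ^ a + c - M))).
  by split => //; exists a, (r ^ a + c - M); split; first lia.
apply/funext => n; rewrite /prepend /=.
have n_gt0 := posint_gt0 n.
case: eqP => [n1|n_neq1].
  by rewrite /offset_section n1 /posint1 /=.
rewrite {1}/term insubd_posintK; last lia.
rewrite /offset_section; congr (term u _).
have -> : r ^ a * n = r ^ a * n.-1 + r ^ a by rewrite -mulnSr prednK.
by rewrite -!addnA addnBA // (leq_trans leM) ?leq_addr.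
Qed.

(** The last digit of [r ^ a.+1 * n + c - r * m] is that of [c], and stripping
    it off leaves [r ^ a * n + c %/ r - m]: this is where it helps that [M] is
    the multiple [r * m] of [r]. *)
Lemma offset_section_digit (r m a c n : nat) :
  m <= r ^ a * n ->
  r ^ a.+1 * n + c - r * m = r * (r ^ a * n + c %/ r - m) + c %% r.
Proof.
move=> le_m; rewrite {1}(divn_eq c r) expnS -mulnA (mulnC (c %/ r)) addnA.
rewrite -mulnDr -addnBAC; first by rewrite -mulnBr.
by rewrite leq_mul2l (leq_trans le_m) ?leq_addr ?orbT.
Qed.

(** Induction on [a], one base-[r] digit at a time.  Relative to the same
    [M = r * m], a digit [j <> i] turns the offset [c] into
    [c %/ r + (r * m - m)], and the digit [i] turns it into
    [c %/ r + (r * m - m - m)], which are both below [r * m + r ^ a]. *)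
Lemma kernel_reduction (r : nat) (hr : 2 <= r) (A : finType) (v : sequence A)
    (sigma : A -> A) (i m : nat) (G : set (sequence A)) :
  (forall n : posint, term (T r i v) (n + m) = sigma (v n)) ->
  (forall a c, a <= r * m -> c < r * m + r ^ a ->
     G (offset_section r (r * m) v a c)) ->
  (forall j a c, j < r -> j <> i -> r * m <= r ^ a -> c < r * m + r ^ a ->
     G (offset_section r (r * m) (T r j v) a c)) ->
  forall a c, c < r * m + r ^ a ->
    relabelings G (offset_section r (r * m) v a c).
Proof.
move=> Hi Gbase Gdigit; elim=> [|a IHa] c ltc.
  by apply/relabelings_self/Gbase.
have [lea|lta] := leqP a.+1 (r * m); first exact/relabelings_self/Gbase.
have ltM : r * m < r ^ a by apply: leq_trans (ltn_expl a hr); rewrite ltnS.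
have le2m : 2 * m <= r * m by rewrite leq_mul2r hr orbT.
have r_gt0 : 0 < r by exact: ltnW.
have ltq : c %/ r < m + r ^ a.
  by rewrite ltn_divLR // mulnC mulnDr -expnS.
have leXn (n : posint) : r ^ a <= r ^ a * n by rewrite leq_pmulr ?posint_gt0.
have [ji|/eqP ji] := eqVneq (c %% r) i.
  (* On the digit [i], [q = (q - m) + m] with [q - m >= 1]. *)
  have -> : offset_section r (r * m) v a.+1 c
      = sigma \o offset_section r (r * m) v a (c %/ r + (r * m - m - m)).
    apply/funext => n; have := leXn n => leX.
    rewrite /= /offset_section offset_section_digit; last lia.
    set q := r ^ a * n + c %/ r - m.
    have -> : r ^ a * n + (c %/ r + (r * m - m - m)) - r * m = q - m by lia.
    have q_gtm : m < q by rewrite ltn_subRL ltn_addr //; lia.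
    have -> : term v (q - m) = v (insubd posint1 (q - m)) by [].
    rewrite -Hi insubd_posintK ?subn_gt0 // subnK ?(ltnW q_gtm) //.
    by rewrite term_T ?ji //; lia.
  by apply/relabelings_comp/IHa; lia.
have -> : offset_section r (r * m) v a.+1 c
    = offset_section r (r * m) (T r (c %% r) v) a (c %/ r + (r * m - m)).
  apply/funext => n; have := leXn n => leX.
  rewrite /offset_section offset_section_digit; last lia.
  have -> : r ^ a * n + (c %/ r + (r * m - m)) - r * m = r ^ a * n + c %/ r - m.
    by lia.
  by rewrite term_T // subn_gt0 ltn_addr // (leq_trans _ leX) //; lia.
by apply/relabelings_self/Gdigit; rewrite ?ltn_pmod //; lia.
Qed.

Theorem theorem3 (r : nat) (hr : 2 <= r) (A : finType) (v : sequence A)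
  (sigma : A -> A) (hsigma : bijective sigma) (i : nat) (hi : i < r) :
  forall m : nat,
    (forall n : posint, term (T r i v) (n + m) = sigma (v n)) ->
    (forall j : nat, j < r -> j <> i -> automatic r (T r j v)) ->
    automatic r v.
Proof.
move=> m Hi Haut; set M := r * m.
pose base := [set offset_section r M v p.1 p.2 | p in
                (`I_M.+1 `*` `I_(M + r ^ M))]%classic.
pose digit := (\bigcup_(j in [set j | j < r /\ j <> i])
  [set w | exists a c, [/\ M <= r ^ a, c < M + r ^ a
                         & w = offset_section r M (T r j v) a c]])%classic.
have finG : finite_set (base `|` digit)%classic.
  rewrite finite_setU; split.
    by apply/finite_image/finite_setX; exact: finite_II.
  apply: bigcup_finite => [|j [jr ji]].
    by apply: (sub_finite_set _ (finite_II r)) => j [].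
  by apply/automatic_offset_sections/Haut.
apply: (sub_finite_set _ (finite_relabelings A _ finG)).
move=> _ [a [b [ltb ->]]].
have -> : (fun n : posint => term v (r ^ a * n + b))
    = offset_section r M v a (b + M).
  by apply/funext => n; rewrite /offset_section addnA addnK.
apply: (kernel_reduction r hr A v sigma i m _ Hi)
  => [a' c lea ltc|j a' c jr ji leM ltc|].
- left; exists (a', c) => //; split => /=; first by rewrite ltnS.
  by apply: leq_trans ltc _; rewrite leq_add2l leq_exp2l.
- by right; exists j => //; exists a', c.
- by rewrite addnC ltn_add2l.
Qed.
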